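(* Let $n\ge 2$ and $M\in\mathrm{GL}(n,\mathbb{R})$ with characteristic polynomial $P(x)=\det(x\mathbf{1}-M)$. If $M$ is reversible, i.e. there is $G\in\mathrm{GL}(n,\mathbb{R})$ with $GMG^{-1}=M^{-1}$, then $\mathrm{spec}(M)=\mathrm{spec}(M^{-1})$ (eigenvalues counted with multiplicity) and thus $$P(x)\;=\;\frac{(-1)^n x^n}{\det(M)}\,P(1/x).$$
   Context: $\mathrm{spec}(M)$ denotes the multiset of complex eigenvalues of $M$ with algebraic multiplicities. *)

(* Defs.v *)
From mathcomp Require Import all_boot all_order all_algebra.
From mathcomp Require Import finmap multiset.
From mathcomp Require Import reals.
From mathcomp Require Import complex.

Set Implicit Arguments.
Unset Strict Implicit.
Unset Printing Implicit Defensive.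

Import GRing.Theory.
Local Open Scope mset_scope.
Local Open Scope ring_scope.

Definition reversible (R : realType) (n : nat) (M : 'M[R]_n) : Prop :=
  exists G : 'M[R]_n, G \in unitmx /\ G *m M *m invmx G = invmx M.

(* The monic polynomial [char_poly (map_mx (real_complex R) M)] splits over
   R[i]; the list chosen by [closed_field_poly_normal] contains each root as
   many times as its algebraic multiplicity (see [spec_mup]), and forgetting
   the order makes the result independent of that choice. *)
Definition spec (R : realType) (n : nat) (M : 'M[R]_n) : {mset R[i]} :=
  seq_mset
    (sval (closed_field_poly_normal (char_poly (map_mx (real_complex R) M)))).

Lemma spec_mup (R : realType) (n : nat) (M : 'M[R]_n) (z : R[i]) :
  spec M z = mup z (char_poly (map_mx (real_complex R) M)).
Proof.
rewrite /spec mset_seqE; case: closed_field_poly_normal => r /=.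
rewrite (monicP (char_poly_monic _)) scale1r => ->.
elim: r => [|a r IHr].
  by rewrite big_nil mupNroot // root1.
rewrite big_cons mupM; first last.
- by rewrite prodf_seq_neq0; apply/allP => x _; rewrite /= polyXsubC_eq0.
- by rewrite polyXsubC_eq0.
by rewrite /= IHr -['X - a%:P]expr1 mup_XsubCX; case: eqVneq.
Qed.

(* Main.v *)
(* Conjugate matrices have the same characteristic polynomial, so reversibility
   gives P_M = P_(M^-1), hence equal spectra.  The functional equation is the
   determinant of [x 1 - M^-1 = (- x) M^-1 (x^-1 1 - M)]. *)
Require Import Defs.
From mathcomp Require Import all_boot all_order all_algebra.
From mathcomp Require Import finmap multiset.
From mathcomp Require Import reals.
From mathcomp Require Import complex.

Import GRing.Theory.
Local Open Scope ring_scope.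

(** Evaluation at [x] is a ring morphism, so it commutes with the determinant. *)
Lemma horner_char_poly (R : comNzRingType) (n : nat) (A : 'M[R]_n) (x : R) :
  (char_poly A).[x] = \det (x%:M - A).
Proof.
rewrite -horner_evalE -det_map_mx; congr (\det _); apply/matrixP => i j.
by rewrite !mxE /= horner_evalE !hornerE hornerMn hornerX.
Qed.

(** Over the polynomial ring the scalar matrix of ['X] commutes with [g], so the conjugation can be
    pulled out of the characteristic matrix, and the determinants of [g] and [g'] cancel. *)
Lemma char_poly_conjmx (R : comUnitRingType) (n : nat) (G A : 'M[R]_n) :
  G \in unitmx -> char_poly (G *m A *m invmx G) = char_poly A.
Proof.
move=> uG; set g := map_mx polyC G; set g' := map_mx polyC (invmx G).
have gg' : g *m g' = 1%:M by rewrite -map_mxM mulmxV // map_mx1.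
have -> : char_poly (G *m A *m invmx G) = \det (g *m char_poly_mx A *m g').
  rewrite /char_poly /char_poly_mx !map_mxM mulmxBr mulmxBl.
  by rewrite scalar_mxC -[_ *m g *m g']mulmxA gg' mulmx1.
by rewrite !det_mulmx mulrAC -det_mulmx gg' det1 mul1r.
Qed.

Lemma horner_char_poly_invmx (F : fieldType) (n : nat) (A : 'M[F]_n) (x : F) :
  A \in unitmx -> x != 0 ->
  (char_poly (invmx A)).[x] =
    (-1) ^+ n * x ^+ n / \det A * (char_poly A).[x^-1].
Proof.
move=> uA x0; rewrite !horner_char_poly.
have -> : x%:M - invmx A = - x *: (invmx A *m (x^-1%:M - A)).
  rewrite mulmxBr mulVmx // mul_mx_scalar scalerBr scalerA mulNr divff //.
  by rewrite scaleN1r scaleNr opprK addrC scalemx1.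
by rewrite detZ det_mulmx det_inv -exprMn mulN1r mulrA.
Qed.

Theorem proposition2 (R : realType) (n : nat) (M : 'M[R]_n)
  (hn : (2 <= n)%N) (hM : M \in unitmx) (hrev : reversible M) :
  let P : {poly R[i]} := map_poly (real_complex R) (char_poly M) in
  spec M = spec (invmx M) /\
  (forall x : R[i], x != 0 ->
     P.[x] = (-1) ^+ n * x ^+ n / real_complex R (\det M) * P.[x^-1]).
Proof.
move=> P; have [G [uG GM]] := hrev.
have charV : char_poly (invmx M) = char_poly M by rewrite -GM char_poly_conjmx.
(* [spec] depends on a matrix only through its complexified characteristic polynomial, so the real
   identity [charV] suffices. *)
split; first by rewrite /spec -!map_char_poly charV.
(* Only the left-hand [P] is traded for the polynomial of the inverse; the previous lemma then leads
   back to [P] at [x^-1]. *)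
move=> x x0; rewrite {1}/P -charV !map_char_poly map_invmx.
by rewrite horner_char_poly_invmx ?map_unitmx // det_map_mx /P map_char_poly.
Qed.
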